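(* Let $n\ge 2$, $a,b\in\mathbb{N}$, $\mathbf{y}=(b,a,a,\dots,a)\in\mathbb{N}^n$ (one entry $b$ followed by $n-1$ entries $a$), and $m=b+(n-1)a$. For $\mathbf{x}=(x_1,\dots,x_n)\in[m]^n$ let $x_{(1)}\le x_{(2)}\le\cdots\le x_{(n)}$ denote the nondecreasing rearrangement of its entries. (a) If $a\mid b$ or $b>(n-1)a$, then for every $\mathbf{x}\in[m]^n$ we have $\mathbf{x}\in\mathsf{PA}^{\mathrm{inv}}_n(\mathbf{y})$ if and only if $$x_{(i)}\in\{1+(k-1)a:k\in[i]\}\quad\text{for all }i\in[n].$$ Moreover, $$|\mathsf{PA}^{\mathrm{inv}}_n(\mathbf{y})|=(n+1)^{n-1}\quad\text{and}\quad|\mathsf{PA}^{\mathrm{inv},\uparrow}_n(\mathbf{y})|=\frac{1}{n+1}\binom{2n}{n}.$$ (b) Otherwise, if $a\nmid b$ and $b<(n-1)a$, then for every $\mathbf{x}\in[m]^n$ we have $\mathbf{x}\in\mathsf{PA}^{\mathrm{inv}}_n(\mathbf{y})$ if and only if $$x_{(i)}\in\begin{cases}\{1+(k-1)a:k\in[i]\}&\text{for all }i\in\left[\lfloor b/a\rfloor+1\right],\\ \left\{1+(k-1)a:k\in\left[\lfloor b/a\rfloor+1\right]\right\}&\text{for all other }i\in[n].\end{cases}$$ Moreover, $$|\mathsf{PA}^{\mathrm{inv}}_n(\mathbf{y})|=\sum_{j=0}^{n-\lfloor b/a\rfloor-1}(-1)^j\binom{n}{j}\left(n-\left\lfloor\frac{b}{a}\right\rfloor-j\right)^j(n-j+1)^{n-j-1}$$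 and $$|\mathsf{PA}^{\mathrm{inv},\uparrow}_n(\mathbf{y})|=\frac{n-\lfloor b/a\rfloor+1}{n+1}\binom{n+\lfloor b/a\rfloor}{\lfloor b/a\rfloor}.$$
   Context: $\mathbb{N}=\{1,2,3,\dots\}$ and $[n]=\{1,\dots,n\}$. Let $\mathbf{y}=(y_1,\dots,y_n)\in\mathbb{N}^n$ and $m=\sum_{i=1}^n y_i$. Consider a one-way street with $m$ parking spots numbered $1,\dots,m$ and $n$ cars entering in order $1,2,\dots,n$, where car $i$ has length $y_i$ and prefers spot $x_i\in[m]$. Car $i$ drives to spot $x_i$ and parks in $x_i,x_i+1,\dots,x_i+y_i-1$ if these spots exist and are all unoccupied; otherwise it parks in the next $y_i$ contiguous available spots, i.e. it occupies $s,s+1,\dots,s+y_i-1$ for the smallest $s\ge x_i$ such that $s+y_i-1\le m$ and all these spots are unoccupied; if no such $s$ exists, parking fails. The vector $\mathbf{x}=(x_1,\dots,x_n)\in[m]^n$ is a parking assortment for $\mathbf{y}$ if all cars can park; the set of these is $\mathsf{PA}_n(\mathbf{y})$. A parking assortment $\mathbf{x}$ is (permutation) invariant if every permutation of its entries is also in $\mathsf{PA}_n(\mathbf{y})$; $\mathsf{PA}^{\mathrm{inv}}_n(\mathbf{y})$ is the set of invariant parking assortments for $\mathbf{y}$, and $\mathsf{PA}^{\mathrm{inv},\uparrow}_n(\mathbf{y})\subseteq\mathsf{PA}^{\mathrm{inv}}_n(\mathbf{y})$ is its subset of nondecreasing elements. *)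

(* Defs.v *)
From mathcomp Require Import all_boot all_order all_algebra.

Set Implicit Arguments.
Unset Strict Implicit.
Unset Printing Implicit Defensive.

(* Spots are the natural numbers 1, ..., m, and [occ] lists the occupied ones.
   [fits m occ l s]: a car of length l can occupy s, s+1, ..., s+l-1. *)
Definition fits (m : nat) (occ : seq nat) (l s : nat) : bool :=
  all (fun t => (t <= m) && (t \notin occ)) (iota s l).

(* The smallest admissible starting spot in p, p+1, ..., m, if there is one. *)
Definition parking_spot (m : nat) (occ : seq nat) (l p : nat) : option nat :=
  ohead [seq s <- iota p (m.+1 - p) | fits m occ l s].

Fixpoint all_park (m : nat) (occ ys xs : seq nat) : bool :=
  match ys, xs with
  | [::], [::] => true
  | y :: ys', x :: xs' =>
      if parking_spot m occ y x is Some s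
      then all_park m (iota s y ++ occ) ys' xs' else false
  | _, _ => false
  end.

Section ParkingAssortments.

Variables (n : nat) (y : n.-tuple nat).

Definition street_length : nat := \sum_(i < n) tnth y i.

(* An element p : 'I_m encodes the spot numbered p + 1, so that
   n.-tuple 'I_m encodes [m]^n; [prefs] recovers the spot numbers. *)
Definition prefs (x : n.-tuple 'I_street_length) : seq nat :=
  [seq (val p).+1 | p <- x].

(* The i-th smallest entry of x, for 1 <= i <= n. *)
Definition order_stat (x : n.-tuple 'I_street_length) (i : nat) : nat :=
  nth 0 (sort leq (prefs x)) i.-1.

Definition PA : {set n.-tuple 'I_street_length} :=
  [set x | all_park street_length [::] y (prefs x)].

Definition PAinv : {set n.-tuple 'I_street_length} :=
  [set x in PA |
    [forall z : n.-tuple 'I_street_length, perm_eq z x ==> (z \in PA)]].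

Definition PAinv_nondecr : {set n.-tuple 'I_street_length} :=
  [set x in PAinv | sorted leq (prefs x)].

End ParkingAssortments.

(* (b, a, ..., a) *)
Definition lengths_ba (n a b : nat) : n.-tuple nat :=
  [tuple if val i == 0 then b else a | i < n].

Lemma street_length_ba (n a b : nat) :
  0 < n -> street_length (lengths_ba n a b) = b + (n - 1) * a.
Proof.
case: n => // n _; rewrite /street_length big_ord_recl tnth_mktuple /=.
rewrite (eq_bigr (fun=> a)) => [|i _]; last by rewrite tnth_mktuple.
by rewrite sum_nat_const card_ord subn1.
Qed.

(* Main.v *)
Require Import Defs.
From mathcomp Require Import all_boot all_order all_algebra.
From mathcomp Require Import zify ring.

Set Implicit Arguments.
Unset Strict Implicit.
Unset Printing Implicit Defensive.

Import GRing.Theory Num.Theory.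

(* The first car parks exactly where it prefers, and the others then tile what
   is left; counting the spots below a given one shows that an invariant x has
   all its entries of the form 1 + k a, that at least i of them satisfy k < i
   (let the largest entry go first), and that k <= b / a unless a divides b (let
   the entry 1 go first, and the offending entry second).  Conversely, under
   these conditions the first car cuts the street into n - 1 slots of length a,
   every later car parks in the first free slot after its preference, and Hall's
   condition guarantees that there is one.  So with r = n if a | b and
   r = min(n, floor(b / a) + 1) otherwise, the two sets are counted by the
   parking functions of length n with values in [r], and by the nondecreasing
   ones.  Removing the cars with the largest value gives a recursion for the
   former, solved with Abel's identity; removing the last entry gives a ballot
   recursion for the latter. *)

(** * Parked cars as disjoint blocks of spots *)

Lemma fits_le m occ l s : 0 < l -> fits m occ l s -> s + l <= m.+1.
Proof.
move=> l0 /allP/(_ (s + l.-1)); rewrite mem_iota => /(_ _)/andP[|+ _]; lia.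
Qed.

Lemma parking_spot_some m occ l p s :
  parking_spot m occ l p = Some s ->
  [/\ p <= s, fits m occ l s & forall t, p <= t < s -> ~~ fits m occ l t].
Proof.
rewrite /parking_spot; move: (m.+1 - p) => k; elim: k p => //= k IHk p.
case: ifPn => [fp [<-]|nfp /IHk[ps fs min_s]].
  by split=> // t; rewrite leqNgt andNb.
split=> // [|t /andP[]]; first exact: ltnW.
by rewrite leq_eqVlt => /predU1P[<- //|pt ts]; apply: min_s; rewrite pt.
Qed.

Lemma parking_spot_min m occ l p s :
  0 < l -> p <= s -> fits m occ l s ->
  (forall t, p <= t < s -> ~~ fits m occ l t) ->
  parking_spot m occ l p = Some s.
Proof.
move=> l0 ps fs min_s; have sl := fits_le l0 fs.
case E: (parking_spot m occ l p) => [t|].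
  have [pt ft min_t] := parking_spot_some E.
  case: (ltngtP s t) => [st|ts|-> //].
    by have := min_t s; rewrite ps st fs => /(_ isT).
  by have := min_s t; rewrite pt ts ft => /(_ isT).
move: E; rewrite /parking_spot; case E: [seq _ <- _ | _] => [|//] _.
have : s \in [seq s <- iota p (m.+1 - p) | fits m occ l s].
  by rewrite mem_filter fs mem_iota; lia.
by rewrite E.
Qed.

Definition spots (ss ys : seq nat) : seq nat :=
  flatten [seq iota p.1 p.2 | p <- zip ss ys].

(** Replaces the run of the parking process by the list [ss] of starting spots, so that what follows
    is about disjoint blocks only. The last clause keeps the one trace of the parking rule needed
    later: a first car whose preferred block is free parks there. *)
Lemma all_park_starts m occ ys xs :
  all (leq 1) ys -> all (leq 1) xs -> uniq occ -> all_park m occ ys xs ->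
  exists ss, [/\ size ss = size ys, all2 leq xs ss,
    uniq (spots ss ys ++ occ), {subset spots ss ys <= iota 1 m} &
    forall x, ohead xs = Some x -> fits m occ (head 0 ys) x -> ohead ss = Some x].
Proof.
elim: ys xs occ => [|y ys IHys] [|x xs] occ //=; first by exists [::].
move=> /andP[y0 ys0] /andP[x0 xs0] Uocc.
case E: parking_spot => [s|//] /IHys - /(_ ys0 xs0).
have [xs_s fs min_s] := parking_spot_some E; have sm := fits_le y0 fs.
have Dis : {in iota s y, forall t, t \notin occ}.
  by move=> t /(allP fs)/andP[].
have U1 : uniq (iota s y ++ occ).
  rewrite cat_uniq iota_uniq Uocc andbT; apply/hasPn => t tocc.
  by apply/negP => /Dis; rewrite tocc.
move=> /(_ U1)[ss [sz le_ss Uss sub _]]; exists (s :: ss); split=> /=.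
- by rewrite sz.
- by rewrite xs_s.
- by rewrite /spots /= -catA -(perm_uniq (permEl (perm_catCA _ _ _))).
- move=> t; rewrite mem_cat => /orP[|/sub //].
  by rewrite !mem_iota /= => ?; apply/andP; lia.
- move=> _ [<-] fx; congr Some; apply/eqP; rewrite eqn_leq xs_s andbT leqNgt.
  by apply: contraL fx => lt; apply: min_s; rewrite leqnn.
Qed.

Lemma spots_nseq ss k a :
  size ss = k -> spots ss (nseq k a) = flatten [seq iota s a | s <- ss].
Proof. by elim: ss k => [|s ss IHss] [|k] //= [/IHss]; rewrite /spots /= => ->. Qed.

Lemma count_ltn_iota v s l : count (ltn^~ v) (iota s l) = minn l (v - s).
Proof. elim: l s => [|l IHl] s //=; first lia. by rewrite IHl; lia. Qed.

(** As [v] lies in no block, each block is entirely below [v], contributing [a], or entirely above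
    it, contributing 0. *)
Lemma dvdn_count_blocks v a ss :
  v \notin flatten [seq iota s a | s <- ss] ->
  a %| count (ltn^~ v) (flatten [seq iota s a | s <- ss]).
Proof.
elim: ss => [|s ss IHss] //=; rewrite mem_cat negb_or count_cat => /andP[vs vss].
rewrite dvdn_addr ?IHss // count_ltn_iota; move: vs; rewrite mem_iota => vs.
have [le|lt] := leqP v s; first by rewrite (_ : v - s = 0) ?minn0 //; lia.
by rewrite (_ : minn a _ = a) //; lia.
Qed.

Lemma count_blocks_le v a ss :
  count (ltn^~ v) (flatten [seq iota s a | s <- ss]) <= count (ltn^~ v) ss * a.
Proof.
elim: ss => [|s ss IHss] //=; rewrite count_cat count_ltn_iota mulnDl leq_add //.
by case: ltnP => sv /=; lia.
Qed.

Lemma count_ltn_all2 v xs ss :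
  all2 leq xs ss -> count (ltn^~ v) ss <= count (ltn^~ v) xs.
Proof.
elim: xs ss => [|x xs IHxs] [|s ss] //= /andP[xs_s /IHxs]; apply: leq_add.
by case: ltnP => //= sv; rewrite (leq_ltn_trans xs_s).
Qed.

(** * Necessity: what invariance forces on the preferences *)

Section Necessity.

Variables (k a b : nat) (ha : 0 < a) (hb : 0 < b).
Local Notation m := (b + k * a).
Local Notation ys := (b :: nseq k a).

(** The blocks are disjoint, lie in the street and have total length [m], so they fill it. The last
    clause holds because a second car preferring a spot behind the first car meets no obstacle. *)
Lemma parking_tiling x1 xs :
  all (leq 1) (x1 :: xs) -> all_park m [::] ys (x1 :: xs) ->
  exists ss, [/\ all2 leq xs ss,
    perm_eq (iota x1 b ++ flatten [seq iota s a | s <- ss]) (iota 1 m) &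
    forall x2, ohead xs = Some x2 -> x1 + b <= x2 -> ohead ss = Some x2].
Proof.
move=> /= /andP[x10 xs0]; case E: parking_spot => [s|//].
have [x1s fs min_s] := parking_spot_some E; have sm := fits_le hb fs.
(* On the empty street the block at [x1] fits, since it ends no later than the block at [s]. *)
have {fs min_s x1s} ? : s = x1.
  apply/eqP; rewrite eqn_leq x1s andbT leqNgt; apply/negP => lt.
  have := min_s x1; rewrite leqnn lt => /(_ isT)/negP[].
  by apply/allP => t; rewrite mem_iota andbT; lia.
subst s; rewrite cats0 => /all_park_starts - /(_ _ xs0 (iota_uniq _ _))[|ss []].
  by apply/allP => y; rewrite mem_nseq => /andP[_ /eqP->].
rewrite size_nseq => sz le_ss; rewrite (spots_nseq _ sz) => U sub head_ss.
have sz_f : size (flatten [seq iota s a | s <- ss]) = k * a.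
  by rewrite -sz; elim: ss {sz le_ss U sub head_ss} => //= ? ? IH;
     rewrite size_cat size_iota IH mulSn.
have sub1 : {subset iota x1 b ++ flatten [seq iota s a | s <- ss] <= iota 1 m}.
  move=> t; rewrite mem_cat => /orP[|/sub //].
  by rewrite !mem_iota => ?; apply/andP; lia.
have U1 : uniq (iota x1 b ++ flatten [seq iota s a | s <- ss]).
  by rewrite (perm_uniq (permEl (perm_catC _ _))).
exists ss; split=> //.
  apply: uniq_perm; rewrite ?iota_uniq //.
  by case: (uniq_min_size U1 sub1) => //; rewrite size_cat !size_iota sz_f.
move=> x2 ohx2 lt; apply: (head_ss _ ohx2).
case: xs ss sz ohx2 le_ss sub {xs0 U head_ss sz_f sub1 U1} => //= x2' xs [|s2 ss] //.
move: (b + k * a) => m; case: k => // k' _ [->] /andP[le _] sub.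
apply/allP => t; rewrite !mem_iota => /= /andP[lo hi].
(* The second car ends inside the street and starts no earlier than [x2], so the block at [x2] ends
   inside the street too. *)
have : s2 + a.-1 \in iota 1 m.
  by apply: sub; rewrite mem_cat mem_iota; apply/orP; left; apply/andP; lia.
by rewrite mem_iota; lia.
Qed.

(** The [x1 - 1] spots before the first car are tiled by blocks of length [a], because [x1] itself
    belongs to the first car. *)
Lemma parking_first_dvdn x1 xs :
  all (leq 1) (x1 :: xs) -> all_park m [::] ys (x1 :: xs) -> a %| x1.-1.
Proof.
move=> xs0 /(parking_tiling xs0)[ss [_ tile _]].
have /= /andP[x10 _] := xs0.
have x1_in : x1 \in iota x1 b by rewrite mem_iota; lia.
have x1m : x1 \in iota 1 m by rewrite -(perm_mem tile) mem_cat x1_in.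
have := perm_uniq tile; rewrite iota_uniq cat_uniq => /and3P[_ /hasPn disj _].
have := dvdn_count_blocks (contraTN (disj x1) x1_in).
move: (permP tile (ltn^~ x1)); rewrite count_cat !count_ltn_iota.
move: x1m; rewrite mem_iota => x1m.
have -> : minn b (x1 - x1) = 0 by lia.
have -> : minn m (x1 - 1) = x1.-1 by lia.
by rewrite add0n => ->.
Qed.

(** The first car fills the spots 1 to [b] and the second starts exactly at [x2]; the spots below
    [x2] therefore number [b] plus a multiple of [a]. *)
Lemma parking_second_dvdn x2 xs :
  all (leq 1) (x2 :: xs) -> all_park m [::] ys (1 :: x2 :: xs) ->
  b < x2 -> a %| x2.-1 -> a %| b.
Proof.
move=> xs0 park bx2 ax2.
have [|ss [_ tile hd]] := parking_tiling (x1 := 1) _ park; first exact: xs0.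
case: ss tile {hd}(hd x2 erefl bx2) => // s2 ss tile [?]; subst s2.
have x2_in : x2 \in iota x2 a by rewrite mem_iota; lia.
have x2m : x2 \in iota 1 m.
  by rewrite -(perm_mem tile) mem_cat /= mem_cat x2_in orbT.
have := perm_uniq tile; rewrite iota_uniq cat_uniq /= cat_uniq.
case/and3P => _ _ /and3P[_ /hasPn disj _].
have := dvdn_count_blocks (contraTN (disj x2) x2_in).
move: (permP tile (ltn^~ x2)); rewrite /= !count_cat !count_ltn_iota.
move: x2m; rewrite mem_iota => x2m.
have -> : minn b (x2 - 1) = b by lia.
have -> : minn a (x2 - x2) = 0 by lia.
have -> : minn m (x2 - 1) = x2.-1 by lia.
by rewrite add0n => E dv; move: ax2; rewrite -E dvdn_addl.
Qed.

(** The first [i * a] spots lie before the first car, so at least [i] of the blocks of length [a]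
    start among them, and a car never parks before its preference. *)
Lemma parking_count_le x1 xs i :
  all (leq 1) (x1 :: xs) -> all_park m [::] ys (x1 :: xs) ->
  i * a < x1 -> i <= count (leq^~ (i * a)) xs.
Proof.
move=> xs0 /(parking_tiling xs0)[ss [le tile _]] lt.
have := permP tile (ltn^~ (i * a).+1).
have x1m : x1 \in iota 1 m.
  by rewrite -(perm_mem tile) mem_cat mem_iota; apply/orP; left; lia.
move: x1m; rewrite mem_iota count_cat !count_ltn_iota => x1m.
have -> : minn b ((i * a).+1 - x1) = 0 by lia.
have -> : minn m ((i * a).+1 - 1) = i * a by lia.
have := count_blocks_le (i * a).+1 a ss.
have := count_ltn_all2 (i * a).+1 le.
rewrite -(leq_pmul2r ha) add0n => le1 le2 E; rewrite -(leq_pmul2r ha).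
by apply: leq_trans (leq_trans le2 le1); rewrite E.
Qed.

End Necessity.

(* Everything is indexed from 0: [ks] stands for the preferences 1 + k a with k
   in [ks], and the i-th smallest k is at most i for i = 0, ..., n - 1. *)
Definition restricted_parking (r : nat) (ks : seq nat) : bool :=
  all (ltn^~ r) ks && all (fun i => i < count (leq^~ i) ks) (iota 0 (size ks)).

Lemma restricted_parkingP r ks :
  reflect ((forall k, k \in ks -> k < r) /\
           (forall i, i < size ks -> i < count (leq^~ i) ks))
          (restricted_parking r ks).
Proof.
apply: (iffP andP) => [[/allP H1 /allP H2]|[H1 H2]]; split=> //.
- by move=> i lt; apply: H2; rewrite mem_iota.
- exact/allP.
- by apply/allP => i; rewrite mem_iota => /andP[_ lt]; apply: H2.
Qed.

Lemma perm_restricted_parking r s t :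
  perm_eq s t -> restricted_parking r s = restricted_parking r t.
Proof.
move=> st; rewrite /restricted_parking (perm_all _ st) (perm_size st).
by congr andb; apply: eq_all => i; rewrite (permP st).
Qed.

(** The [minn] makes the case [(n - 1) * a < b] yield [n], as when [a] divides [b]; part (a) is thus
    the single case of value [n]. *)
Definition max_step (n a b : nat) : nat :=
  if a %| b then n else minn n (b %/ a).+1.

Lemma leq_count_in (T : eqType) (P Q : pred T) s :
  {in s, forall x, P x -> Q x} -> count P s <= count Q s.
Proof.
move=> PQ; rewrite (@eq_in_count _ P (predI P Q)) => [|x /PQ /=].
  by apply: sub_count => x /andP[].
by case: (P x) => // ->.
Qed.

Lemma restricted_of_parking k a b s :
  0 < a -> 0 < b -> size s = k.+1 -> all (leq 1) s ->
  (forall t, perm_eq t s -> all_park (b + k * a) [::] (b :: nseq k a) t) ->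
  exists2 ks, s = [seq 1 + j * a | j <- ks] &
    restricted_parking (max_step k.+1 a b) ks.
Proof.
move=> ha hb sz_s s0 park; pose key x := x.-1 %/ a.
have pos t : perm_eq t s -> all (leq 1) t by move/perm_all->.
have dv x : x \in s -> a %| x.-1.
  move/perm_to_rem; rewrite perm_sym => p.
  exact: (parking_first_dvdn ha hb (pos _ p) (park _ p)).
have keyK x : x \in s -> 1 + key x * a = x.
  by move=> xs; rewrite divnK ?dv // add1n prednK // (allP s0).
(* Otherwise some entry [x] has key above [i]. With [x] in front, [parking_count_le] at [i.+1]
   yields [i.+1] other entries, all of key at most [i]. *)
have cnt i : i < k.+1 -> i < count (leq^~ i) (map key s).
  move=> ik; rewrite ltnNge; apply/negP => le.
  have : ~~ all (leq^~ i) (map key s).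
    by rewrite all_count size_map sz_s neq_ltn (leq_ltn_trans le ik).
  rewrite -has_predC => /hasP[_ /mapP[x xs ->]] /=; rewrite -ltnNge => ix.
  have := xs; move/perm_to_rem; rewrite perm_sym => p.
  have lt : i.+1 * a < x.
    by rewrite -[X in _ < X](keyK x xs) add1n ltnS leq_mul2r ix orbT.
  have := parking_count_le ha hb (pos _ p) (park _ p) lt.
  apply/negP; rewrite -leqNgt; apply: leq_trans le.
  rewrite count_map -(permP p (preim key (leq^~ i))).
  apply: leq_trans (leq_addl _ _); apply: leq_count_in => y /mem_rem ys /=.
  by rewrite -{1}(keyK y ys) add1n ltn_mul2r ha.
exists (map key s).
  by rewrite -map_comp map_id_in // => x xs; apply: keyK.
apply/restricted_parkingP; rewrite size_map sz_s; split=> // _ /mapP[x xs ->].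
have xk : key x < k.+1.
  have : all (leq^~ k) (map key s).
    by rewrite all_count size_map sz_s eqn_leq cnt // -sz_s -(size_map key) count_size.
  by move/allP/(_ _ (map_f key xs)).
rewrite /max_step; case: ifPn => // nab; rewrite leq_min xk /= ltnS leqNgt.
apply/negP => fx; have bx : b < x.
  rewrite -(keyK x xs) add1n ltnS ltnW //.
  by apply: leq_trans (ltn_ceil b ha) _; rewrite leq_mul2r fx orbT.
(* The count at 0 provides an entry 1. Placed first, it makes the long car end at [b], and [x],
   which lies beyond, can go second. *)
have ones : 1 \in s.
  have := cnt 0 isT; rewrite -has_count => /hasP[_ /mapP[y ys ->]].
  by rewrite /= leqn0 => /eqP y0; have := keyK y ys; rewrite y0 mul0n addn0 => ->.
have p : perm_eq (1 :: x :: rem x (rem 1 s)) s.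
  rewrite perm_sym; apply: perm_trans (perm_to_rem ones) _; rewrite perm_cons.
  apply: perm_to_rem; have := perm_mem (perm_to_rem ones) x.
  by rewrite xs inE; case: eqP => // x1 _; move: bx hb; rewrite x1; lia.
have /= x0 := pos _ p.
by move/negP: nab; apply; apply: (parking_second_dvdn ha hb x0 (park _ p) bx (dv x xs)).
Qed.

(** * Sufficiency: the later cars park in slots *)

Section Sufficiency.

Variables (k a b K : nat) (ha : 0 < a) (hb : 0 < b) (hK : K <= k).
Local Notation m := (b + k * a).

(* Once the first car has parked in [1 + K a, K a + b], the rest of the street
   splits into k slots of length a, which start at [slot 0], ..., [slot (k - 1)]. *)
Let slot t := 1 + t * a + (if t < K then 0 else b).
Let admissible x := exists2 j, x = 1 + j * a & (a %| b) || (j * a <= b).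

Lemma slot_disjoint t u y :
  y \in iota (slot t) a -> y \in iota (slot u) a -> t = u.
Proof.
rewrite !mem_iota => yt yu.
have [lt|lt|//] := ltngtP t u.
  have := leq_mul lt (leqnn a); rewrite mulSn => ?.
  by move: yt yu; rewrite /slot; case: (ltnP t K); case: (ltnP u K); lia.
have := leq_mul lt (leqnn a); rewrite mulSn => ?.
by move: yt yu; rewrite /slot; case: (ltnP t K); case: (ltnP u K); lia.
Qed.

Lemma slot_first_disjoint t y :
  y \in iota (slot t) a -> y \notin iota (1 + K * a) b.
Proof.
rewrite !mem_iota /slot; case: (ltnP t K) => tK; have := leq_mul tK (leqnn a).
  by rewrite mulSn; lia.
by lia.
Qed.

Lemma slot_le_street t y : t < k -> y \in iota (slot t) a -> 0 < y <= m.
Proof.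
move=> tk; rewrite mem_iota /slot; have := leq_mul tk (leqnn a); rewrite mulSn.
by case: (ltnP t K); lia.
Qed.

Lemma ltn_slot t u : t < u -> slot t < slot u.
Proof.
move=> lt; have := leq_mul lt (leqnn a); rewrite mulSn /slot.
by case: (ltnP t K); case: (ltnP u K); lia.
Qed.

(** An admissible preference never points strictly inside a slot. Before the first car, slots start
    at values [1 + j * a]; behind it they do so again if [a] divides [b], and in any case start at
    [1 + b] or later, which settles the preferences with [j * a <= b]. *)
Lemma slot_of_spot s : 0 < s <= m -> s \notin iota (1 + K * a) b ->
  exists u, [/\ u < k, s \in iota (slot u) a &
    forall x, admissible x -> x <= s -> x <= slot u].
Proof.
move=> sm; rewrite mem_iota => out.
have := hK; rewrite -(leq_pmul2r ha) => hK'.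
have [sK|Ks] := leqP s (K * a).
  exists (s.-1 %/ a); have uK : s.-1 %/ a < K by rewrite ltn_divLR //; lia.
  have := divn_eq s.-1 a; have := ltn_pmod s.-1 ha => ? ?.
  rewrite /slot uK addn0; split; first exact: leq_trans hK.
    by rewrite mem_iota; lia.
  move=> _ [j -> _] js; rewrite leq_add2l leq_pmul2r // leq_divRL //; lia.
have {out Ks} Ks : K * a + b < s by lia.
pose v := s - 1 - b; exists (v %/ a).
have uK : K <= v %/ a by rewrite leq_divRL //; lia.
have := divn_eq v a; have := ltn_pmod v ha => ? ?.
have -> : slot (v %/ a) = 1 + v %/ a * a + b by rewrite /slot ltnNge uK.
split.
- by rewrite ltn_divLR //; lia.
- by rewrite mem_iota; lia.
move=> _ [j -> /orP[/dvdnP[c bE]|jb]] js; last first.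
  by rewrite -addnA leq_add2l (leq_trans jb) ?leq_addl.
rewrite -addnA leq_add2l bE -mulnDl leq_pmul2r // addnC -divnMDl // leq_divRL //.
by rewrite -bE /v; lia.
Qed.

(** Here [U] holds the taken slots and [ps] the preferences of the cars in them; [inv] expresses
    that no parked car passed a free slot. If the last free slot [t] started before [x], then
    [k - t.+1] parked cars and the current one would prefer spots beyond [slot t], leaving only [t]
    cars where [hall] asks for [t.+1]. *)
Lemma free_slot_exists x U ps xs :
  (forall u, u \in U -> u < k) -> uniq U ->
  size U = size ps -> size ps + size (x :: xs) = k ->
  (forall t, t < k -> t < count (leq^~ (slot t)) (ps ++ x :: xs)) ->
  (forall t, t < k -> t \notin U -> count (ltn t) U <= count (ltn (slot t)) ps) ->
  exists t, [&& t < k, t \notin U & x <= slot t].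
Proof.
move=> Uk Uu sz szk hall inv.
have [|none] := boolP (has (fun t => (t \notin U) && (x <= slot t)) (iota 0 k)).
  by move=> /hasP[t]; rewrite mem_iota => /andP[_ tk] ?; exists t; rewrite tk.
have {}none t : t < k -> t \notin U -> slot t < x.
  move=> tk tU; rewrite ltnNge; apply: contra none => le.
  by apply/hasP; exists t; rewrite ?mem_iota ?tU.
have exf : exists t, (t < k) && (t \notin U).
  have [sub|] := boolP (all (mem U) (iota 0 k)).
    have := uniq_leq_size (iota_uniq 0 k) (allP sub).
    by rewrite size_iota sz -szk /=; lia.
  by move=> /allPn[t]; rewrite mem_iota => /andP[_ ?] ?; exists t; apply/andP.
have bnd t : (t < k) && (t \notin U) -> t <= k by case/andP => /ltnW.
case: (ex_maxnP exf bnd) => t /andP[tk tU] tmax.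
have above : k - t.+1 <= count (ltn t) U.
  rewrite -size_filter -(size_iota t.+1 (k - t.+1)).
  apply: uniq_leq_size (iota_uniq _ _) _ => u; rewrite mem_iota => utk.
  rewrite mem_filter; apply/andP; split; first by move: utk => /andP[].
  by apply/negPn/negP => uU; have := tmax u; rewrite uU; lia.
have := hall t tk; have := inv t tk tU; have := none t tk tU.
have := count_predC (leq^~ (slot t)) (ps ++ x :: xs).
rewrite !count_cat size_cat /= szk (@eq_count _ (predC _) (ltn (slot t))).
  by move=> + lt; rewrite [x <= _]leqNgt lt /=; lia.
by move=> y /=; rewrite -ltnNge.
Qed.

(** Induction along the queue: each car takes the first free slot at or after its preference. Hall's
    condition bears on [ps ++ xs], whose counts do not change when a car moves from [xs] to [ps]. *)
Lemma all_park_slots U ps xs occ :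
  (forall u, u \in U -> u < k) -> uniq U ->
  size U = size ps -> size ps + size xs = k ->
  (forall y, (y \in occ) = (y \in iota (1 + K * a) b) ||
                           has (fun u => y \in iota (slot u) a) U) ->
  (forall x, x \in xs -> admissible x) ->
  (forall t, t < k -> t < count (leq^~ (slot t)) (ps ++ xs)) ->
  (forall t, t < k -> t \notin U -> count (ltn t) U <= count (ltn (slot t)) ps) ->
  all_park m occ (nseq (size xs) a) xs.
Proof.
elim: xs U ps occ => [//|x xs IHxs] U ps occ Uk Uu sz szk occE adm hall inv.
have [t0 free] := free_slot_exists Uk Uu sz szk hall inv.
have exf : exists t, [&& t < k, t \notin U & x <= slot t] by exists t0.
case: (ex_minnP exf) => t /and3P[tk tU xt] tmin.
rewrite /=; have -> : parking_spot m occ a x = Some (slot t).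
  apply: parking_spot_min => // [|s /andP[xs_s st]].
    apply/allP => y yt; have /andP[_ ->] := slot_le_street tk yt.
    rewrite occE (negPf (slot_first_disjoint yt)) /=; apply/hasPn => u uU.
    by apply: contra tU => yu; rewrite (slot_disjoint yt yu).
  (* An earlier start [s] would lie in a free slot [u] with [x <= slot u]; minimality gives
     [t <= u], against [slot u <= s < slot t]. *)
  apply/negP => /allP/(_ s); rewrite mem_iota leqnn -{1}[s]addn0 ltn_add2l ha.
  move=> /(_ isT)/andP[sm]; rewrite occE negb_or => /andP[s1 sU].
  have s0 : 0 < s by case: (adm x (mem_head _ _)) xs_s => j -> _; lia.
  have [|u [uk su /(_ x (adm x (mem_head _ _)) xs_s) xu]] := slot_of_spot _ s1.
    by rewrite s0.
  have uU : u \notin U by apply: contra sU => uU; apply/hasP; exists u.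
  have := tmin u; rewrite uk uU xu => /(_ isT); rewrite leqNgt => /negP; apply.
  rewrite ltnNge; apply/negP => tu; move: su; rewrite mem_iota => /andP[us _].
  have := leq_ltn_trans us st; rewrite ltnNge.
  by move: tu; rewrite leq_eqVlt => /predU1P[->|/ltn_slot/ltnW ->] //; rewrite leqnn.
apply: (IHxs (t :: U) (x :: ps)).
- by move=> u; rewrite inE => /predU1P[->|/Uk].
- by rewrite /= tU.
- by rewrite /= sz.
- by rewrite /= -szk addnS.
- by move=> y; rewrite mem_cat occE /= orbCA.
- by move=> y ys; apply: adm; rewrite inE ys orbT.
- move=> u uk; have := hall u uk; rewrite !count_cat /=; lia.
move=> u uk; rewrite inE negb_or => /andP[ut uU] /=; apply: leq_add; last exact: inv.
(* The new car counts on the left only if [u < t]; by minimality of [t] it then prefers a spot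
   beyond [slot u] and counts on the right too. *)
case: (ltnP u t) => //= lt; case: (leqP x (slot u)) => // xu.
by have := tmin u; rewrite uk uU xu => /(_ isT); rewrite leqNgt lt.
Qed.

End Sufficiency.

(** The hypothesis counts the first car as well, whereas Hall's condition for the [k] slots concerns
    the others; the cases below compensate for its removal. *)
Lemma all_park_restricted k a b ks :
  0 < a -> 0 < b -> size ks = k.+1 ->
  restricted_parking (max_step k.+1 a b) ks ->
  all_park (b + k * a) [::] (b :: nseq k a) [seq 1 + j * a | j <- ks].
Proof.
move=> ha hb; case: ks => //= K ks [sz] /restricted_parkingP[lt_r cnt].
have Kk : K <= k.
  have := lt_r K (mem_head _ _); rewrite /max_step.
  by case: ifP => //; rewrite leq_min ltnS => _ /andP[].
have Kka : K * a <= k * a by rewrite leq_mul2r Kk orbT.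
rewrite (@parking_spot_min _ _ _ _ (1 + K * a)) //; last 2 first.
- by apply/allP => y; rewrite mem_iota andbT; lia.
- by move=> t; rewrite leqNgt andNb.
rewrite cats0 -[in nseq k a]sz -(size_map (fun j => 1 + j * a) ks).
have key j : j \in K :: ks -> (a %| b) || (j * a <= b).
  move=> /lt_r; rewrite /max_step; case: (a %| b) => //=.
  by rewrite leq_min !ltnS => /andP[_]; rewrite leq_divRL.
apply: (all_park_slots (K := K) ha hb Kk (U := [::]) (ps := [::])) => //.
- by rewrite size_map.
- by move=> y; rewrite orbF.
- by move=> _ /mapP[j jk ->]; exists j => //; apply: key; rewrite inE jk orbT.
move=> t tk; rewrite count_map.
have [tK|Kt] := ltnP t K.
  have := cnt t; rewrite /= ltnS sz ltnW // => /(_ isT).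
  rewrite [K <= t]leqNgt tK /= => /leq_trans-> //; apply: sub_count => j /= jt.
  by rewrite addn0 leq_add2l leq_mul2r jt orbT.
(* If [a] does not divide [b], every preference is at most [1 + b], hence at most [slot t], and all
   [k] later cars count. *)
have [ab|nab] := boolP (a %| b); last first.
  rewrite (@eq_in_count _ _ predT) ?count_predT ?sz // => j jk /=.
  have := key j; rewrite inE jk orbT (negPf nab) => /(_ isT) /= jb.
  by rewrite -addnA leq_add2l (leq_trans jb) ?leq_addl.
(* Now [a <= b], so [slot t] is at least [1 + t.+1 * a]: the count at [t.+1] applies, and the one
   lost to the first car is harmless. *)
have := cnt t.+1; rewrite /= ltnS sz => /(_ tk).
rewrite (leqW Kt) add1n ltnS => /leq_trans-> //; apply: sub_count => j /= jt.
rewrite add1n addSn ltnS (leq_trans (n := t.+1 * a)) //.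
  by rewrite leq_mul2r jt orbT.
by rewrite mulSnr leq_add2l dvdn_leq.
Qed.

(** * Order statistics, and the passage from lists to tuples *)

Lemma nth_sorted_le s i v : sorted leq s -> i < size s ->
  (nth 0 s i <= v) = (i < count (leq^~ v) s).
Proof.
move=> srt si; apply/idP/idP => [le|].
  rewrite -(cat_take_drop i.+1 s) count_cat; apply: leq_trans (leq_addr _ _).
  have /eqP -> : count (leq^~ v) (take i.+1 s) == size (take i.+1 s).
    rewrite -all_count; apply/(all_nthP 0) => j; rewrite size_takel // => ji.
    rewrite nth_take //; apply: leq_trans le.
    by apply: (sorted_leq_nth leq_trans leqnn) => //; rewrite inE ?(leq_ltn_trans _ si).
  by rewrite size_takel.
rewrite ltnNge; apply: contraR; rewrite -ltnNge => lt.
rewrite -(cat_take_drop i s) count_cat.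
have -> : count (leq^~ v) (drop i s) = 0.
  apply/eqP; rewrite -leqn0 leqNgt -has_count; apply/hasPn => x.
  move=> /(nthP 0)[j]; rewrite size_drop nth_drop => js <-; rewrite -ltnNge.
  apply: leq_trans lt _; apply: (sorted_leq_nth leq_trans leqnn); rewrite ?inE //.
    by rewrite -ltn_subRL.
  by rewrite leq_addr.
by rewrite addn0 (leq_trans (count_size _ _)) // size_take; case: ifP => //; lia.
Qed.

(** The bound on each order statistic becomes a count through [nth_sorted_le]. Indices and steps
    start at 0 on the left and at 1 on the right. *)
Lemma restricted_parking_sort a r s : 0 < a ->
  (exists2 ks, s = [seq 1 + j * a | j <- ks] & restricted_parking r ks) <->
  (forall i, 1 <= i <= size s ->
     nth 0 (sort leq s) i.-1 \in [seq 1 + (j - 1) * a | j <- iota 1 (minn i r)]).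
Proof.
move=> ha.
have srt : sorted leq (sort leq s) by apply: sort_sorted leq_total _.
have sz : size (sort leq s) = size s := size_sort _ _.
have pm : perm_eq (sort leq s) s by rewrite perm_sort.
split=> [[ks sE /restricted_parkingP[lt_r cnt]] [//|i] /= si|stat].
  have szk : size s = size ks by rewrite sE size_map.
  have : nth 0 (sort leq s) i \in s by rewrite -(perm_mem pm) mem_nth ?sz.
  have : nth 0 (sort leq s) i <= 1 + i * a.
    rewrite nth_sorted_le ?sz // (permP pm) sE count_map.
    apply: leq_trans (cnt i _) _; first by rewrite -szk.
    by apply: sub_count => j /= ji; rewrite leq_add2l leq_mul2r ji orbT.
  move=> le s_i; have /mapP[j jk jE] : nth 0 (sort leq s) i \in [seq 1 + j * a | j <- ks].
    by rewrite -sE.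
  rewrite jE in le *.
  apply/mapP; exists j.+1; last by rewrite subn1.
  rewrite mem_iota add1n !ltnS leq_min (lt_r _ jk) andbT ltnS.
  by move: le; rewrite leq_add2l leq_pmul2r.
have key x : x \in s -> exists2 j, j < r & x = 1 + j * a.
  rewrite -(perm_mem pm) => /(nthP 0)[i]; rewrite sz => si <-.
  have /= := stat i.+1 si => /mapP[j]; rewrite mem_iota => jr ->.
  by exists (j - 1) => //; lia.
exists [seq x.-1 %/ a | x <- s].
  rewrite -map_comp map_id_in // => x /key[j _ ->] /=.
  by rewrite add1n mulnK.
apply/restricted_parkingP; rewrite size_map; split=> [_ /mapP[x /key[j jr ->] ->]|i si].
  by rewrite add1n mulnK.
have /= /mapP[j] := stat i.+1 si; rewrite mem_iota => jr jE.
have : nth 0 (sort leq s) i <= 1 + i * a.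
  by rewrite jE leq_add2l leq_mul2r; apply/orP; right; lia.
rewrite nth_sorted_le ?sz // (permP pm) count_map => /leq_trans->//.
apply: leq_count_in => x /key[l _ ->] /=.
by rewrite leq_add2l leq_pmul2r // add0n mulnK.
Qed.

Lemma lengths_baE k a b : tval (lengths_ba k.+1 a b) = b :: nseq k a.
Proof.
rewrite /= enum_ordSl /= -map_comp; congr cons.
rewrite (@eq_map _ _ _ (fun=> a)) => [|i] //=.
have /all_pred1P : all (pred1 a) [seq a | _ <- enum 'I_k].
  by apply/allP => _ /mapP[? _ ->] /=.
by rewrite size_map size_enum_ord.
Qed.

(** Invariance quantifies over tuples; this lifts a rearrangement of the list of spots to one of the
    tuple. *)
Lemma perm_prefs n (y : n.-tuple nat) (x : n.-tuple 'I_(street_length y)) t :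
  perm_eq t (prefs x) ->
  exists2 z : n.-tuple 'I_(street_length y), t = prefs z & perm_eq z x.
Proof.
move=> /(perm_iotaP 0)[Is]; rewrite size_map size_tuple => pI tE.
have szI : size Is = n by rewrite (perm_size pI) size_iota.
case: n y x szI pI tE => [|n] y x szI pI tE.
  by exists x => //; rewrite tE (size0nil szI) /prefs; case: (tval x) (size_tuple x).
pose x0 := tnth x ord0.
have szz : size [seq nth x0 x i | i <- Is] == n.+1 by rewrite size_map szI.
exists (Tuple szz) => /=.
  rewrite tE /prefs /= -map_comp; apply/eq_in_map => i.
  by rewrite (perm_mem pI) mem_iota => /= ilt; rewrite (nth_map x0) ?size_tuple.
by apply/(perm_iotaP x0); exists Is; rewrite ?size_tuple.
Qed.

Lemma mem_PAinv k a b (x : k.+1.-tuple 'I_(street_length (lengths_ba k.+1 a b))) :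
  0 < a -> 0 < b ->
  x \in PAinv (lengths_ba k.+1 a b) <->
  exists2 ks, prefs x = [seq 1 + j * a | j <- ks] &
    restricted_parking (max_step k.+1 a b) ks.
Proof.
move=> ha hb.
have PAE z : (z \in PA (lengths_ba k.+1 a b)) =
    all_park (b + k * a) [::] (b :: nseq k a) (prefs z).
  by rewrite inE lengths_baE [X in all_park X]street_length_ba // subn1.
have sz_x : size (prefs x) = k.+1 by rewrite size_map size_tuple.
rewrite inE PAE; split=> [/andP[_ /forallP/= inv]|[ks xE rks]].
  apply: restricted_of_parking => //; first by apply/allP => _ /mapP[? _ ->].
  by move=> t /perm_prefs[z -> zx]; rewrite -PAE; apply: implyP (inv z) zx.
have park ls : perm_eq ls ks ->
    all_park (b + k * a) [::] (b :: nseq k a) [seq 1 + j * a | j <- ls].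
  move=> pl; apply: all_park_restricted => //.
    by rewrite (perm_size pl) -(size_map (fun j => 1 + j * a)) -xE.
  by rewrite (perm_restricted_parking _ pl).
rewrite xE park //=; apply/forallP => z; apply/implyP => zx; rewrite PAE.
have : perm_eq (prefs z) (prefs x) by apply: perm_map.
rewrite xE => /(perm_iotaP 1)[Is]; rewrite size_map => pI ->.
have -> : [seq nth 1 [seq 1 + j * a | j <- ks] i | i <- Is] =
          [seq 1 + j * a | j <- [seq nth 0 ks i | i <- Is]].
  rewrite -map_comp; apply/eq_in_map => i; rewrite (perm_mem pI) mem_iota /= => ik.
  by rewrite (nth_map 0).
by apply: park; apply/(perm_iotaP 0); exists Is.
Qed.

(** * Abel's identity *)

(** Trinomial revision: multiplied by the factorials of [q], [p - q] and [n - p], both sides become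
    the factorial of [n]. *)
Lemma mul_bin_sub n p q : q <= p <= n ->
  'C(n, p) * 'C(p, q) = 'C(n, q) * 'C(n - q, p - q).
Proof.
move=> /andP[qp pn]; apply/eqP.
rewrite -(eqn_pmul2r (fact_gt0 q)) -(eqn_pmul2r (fact_gt0 (p - q))).
rewrite -(eqn_pmul2r (fact_gt0 (n - p))); apply/eqP.
have E1 := bin_fact pn; have E2 := bin_fact qp.
have E3 := bin_fact (leq_trans qp pn).
have := @bin_fact (n - q) (p - q) (leq_sub2r _ pn).
rewrite (_ : n - q - (p - q) = n - p); last by lia.
move: ('C(_, _)) E1 ('C(_, _)) E2 ('C(_, _)) E3 ('C(_, _)).
move: (n`!) (p`!) (q`!) ((n - p)`!) ((n - q)`!) ((p - q)`!).
move=> fn fp fq fnp fnq fpq c1 E1 c2 E2 c3 E3 c4 E4.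
transitivity fn; first by rewrite -E1 -E2; ring.
by rewrite -E3 -E4; ring.
Qed.

Section RingIdentities.

Variable R : comNzRingType.
Local Open Scope ring_scope.

(** Up to the sign [(-1) ^+ N], the [N]-th forward difference of [g] at 0. *)
Let alt_sum N (g : nat -> R) := \sum_(k < N.+1) (-1) ^+ k * 'C(N, k)%:R * g k.

Lemma alt_sumS N g : alt_sum N.+1 g = alt_sum N g - alt_sum N (fun k => g k.+1).
Proof.
rewrite /alt_sum big_ord_recl /= bin0.
under eq_bigr => k _ do
  rewrite /bump /= add1n binS natrD mulrDr mulrDl exprS mulN1r !mulNr.
rewrite big_split /= addrA sumrN; congr (_ + _); last first.
  by rewrite -sumrN; apply: eq_bigr.
rewrite -sumrN; transitivity (\sum_(k < N.+2) (-1) ^+ k * 'C(N, k)%:R * g k).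
  rewrite [RHS]big_ord_recl /= bin0; congr (_ + _); apply: eq_bigr => k _.
  by rewrite /bump /= add1n exprS mulN1r !mulNr.
by rewrite big_ord_recr /= bin_small // mulr0 mul0r addr0.
Qed.

(** One difference turns the power [j] into a combination of powers [i < j], to which the induction
    hypothesis applies. *)
Lemma alt_sum_pow N j : (j < N)%N -> alt_sum N (fun k => k.+1%:R ^+ j) = 0.
Proof.
elim: N j => // N IHN j jN; rewrite alt_sumS -sumrB.
transitivity (- \sum_(i < j) 'C(j, i)%:R * alt_sum N (fun k => k.+1%:R ^+ i)).
  rewrite /alt_sum; under [in RHS]eq_bigr => i _ do rewrite mulr_sumr.
  rewrite exchange_big -sumrN /=; apply: eq_bigr => k _.
  have -> : k.+2%:R ^+ j = \sum_(i < j) 'C(j, i)%:R * k.+1%:R ^+ i + k.+1%:R ^+ j :> R.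
    rewrite -[k.+2]add1n natrD exprDn big_ord_recr /= subnn expr0 mul1r binn.
    congr (_ + _); apply: eq_bigr => i _.
    by rewrite expr1n mul1r mulr_natl.
  rewrite -mulrBr opprD addrCA subrr addr0 mulrN mulr_sumr; congr (- _).
  by apply: eq_bigr => i _; rewrite mulrCA.
rewrite big1 ?oppr0 // => i _; rewrite IHN ?mulr0 //.
exact: leq_trans (ltn_ord i) _.
Qed.

(** The range is made independent of [l], so that sums can be exchanged; the added terms have a zero
    binomial coefficient. *)
Lemma exprDn_widen n l (x y : R) : (l <= n)%N ->
  (x + y) ^+ l = \sum_(i < n.+1) 'C(l, i)%:R * x ^+ (l - i) * y ^+ i.
Proof.
move=> ln; rewrite exprDn (big_ord_widen n.+1 (fun i => x ^+ (l - i) * y ^+ i *+ 'C(l, i))) //.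
rewrite [RHS](bigID (fun i : 'I_n.+1 => i < l.+1)%N) /= [X in _ + X]big1 ?addr0.
  by apply: eq_bigr => i _; rewrite -mulr_natl mulrA.
by move=> i; rewrite -leqNgt => li; rewrite bin_small // !mul0r.
Qed.

(* Abel's identity: expand [y - k] as [(y + 1) - (k + 1)]; the coefficient of
   [(y + 1) ^+ i] is then an [n - i]-th finite difference of a polynomial of
   degree [n - i - 1]. *)
Lemma abel_sum n (y : R) :
  \sum_(k < n.+1) 'C(n, k)%:R * k.+1%:R ^+ k.-1 * (y - k%:R) ^+ (n - k) =
  (y + 1) ^+ n.
Proof.
transitivity (\sum_(i < n.+1) (y + 1) ^+ i *
  \sum_(k < n.+1) ('C(n, k) * 'C(n - k, i))%:R *
                  (k.+1%:R ^+ k.-1 * (- k.+1%:R) ^+ (n - k - i))).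
  under [RHS]eq_bigr => i _ do rewrite mulr_sumr.
  rewrite exchange_big /=; apply: eq_bigr => k _.
  have -> : y - k%:R = - k.+1%:R + (y + 1) by rewrite -natr1; ring.
  rewrite (@exprDn_widen n) ?leq_subr // mulr_sumr; apply: eq_bigr => i _.
  by rewrite natrM; ring.
(* The index [i = n] gives the right-hand side, through [k = 0] alone; all other [i] give 0. *)
rewrite big_ord_recr /= big1 ?add0r.
  rewrite big_ord_recl /= big1 => [|k _].
    by rewrite subn0 subnn bin0 binn !expr0 !mulr1 addr0 mulr1.
  by rewrite ['C(n - _, n)]bin_small ?muln0 ?mul0r // /bump; have := ltn_ord k; lia.
move=> i _; set N := (n - i)%N.
have N0 : (0 < N)%N by rewrite subn_gt0.
transitivity ((y + 1) ^+ i * ('C(n, i)%:R * (-1) ^+ N * alt_sum N (fun k => k.+1%:R ^+ N.-1))).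
  congr (_ * _); rewrite mulr_sumr.
  rewrite (big_ord_widen n.+1 (fun k => 'C(n, i)%:R * (-1) ^+ N *
     ((-1) ^+ k * 'C(N, k)%:R * k.+1%:R ^+ N.-1))); last by rewrite ltnS leq_subr.
  rewrite [LHS](bigID (fun k : 'I_n.+1 => k < N.+1)%N) /= [X in _ + X]big1 ?addr0.
    apply: eq_bigr => k; rewrite ltnS => kN.
    have kin : (k + i <= n)%N by move: kN; rewrite leq_subRL ?(ltnW (ltn_ord i)) // addnC.
    have -> : ('C(n, k) * 'C(n - k, i) = 'C(n, i) * 'C(N, k))%N.
      rewrite -(bin_sub (n := n) (m := k)); last by lia.
      rewrite mul_bin_sub; last by lia.
      by rewrite -(bin_sub (n := N) (m := k)) //; congr (_ * 'C(_, _))%N; rewrite /N; lia.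
    rewrite natrM exprNn (_ : (n - k - i = N - k)%N); last by rewrite /N; lia.
    have -> : (-1) ^+ N = (-1) ^+ (N - k) * (-1) ^+ k :> R by rewrite -exprD subnK.
    have -> : k.+1%:R ^+ N.-1 = k.+1%:R ^+ k.-1 * k.+1%:R ^+ (N - k) :> R.
      (* At [k = 0] the exponents do not add up, since [0.-1 = 0], but the base is 1. *)
      case: (val k) kN => [|k'] kN; first by rewrite !expr1n mulr1.
      by rewrite -exprD; congr (_ ^+ _); lia.
    have sq : (-1) ^+ k * (-1) ^+ k = 1 :> R by rewrite -expr2 sqrr_sign.
    rewrite -[X in X * 'C(N, k)%:R]mulr1 -{1}sq; ring.
  move=> k; rewrite -leqNgt => kN; rewrite ['C(n - k, i)]bin_small ?muln0 ?mul0r //.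
  by move: (ltn_ord k) kN; rewrite /N; lia.
by rewrite alt_sum_pow ?mulr0 // prednK.
Qed.

End RingIdentities.

(** * A recursion counting restricted parking functions *)

(** Here [p] is the number of cars with value below the largest one [r']; the guard is the count
    condition at [r'], where all [n] cars are counted. *)
Fixpoint parking_count (r n : nat) : nat :=
  if r is r'.+1 then
    if r' < n then \sum_(p < n.+1) 'C(n, p) * parking_count r' p else 0
  else n == 0.

Lemma sum_subsets (T : finType) (D : {set T}) (g : nat -> nat) :
  \sum_(E : {set T} | E \subset D) g #|E| = \sum_(p < #|D|.+1) 'C(#|D|, p) * g p.
Proof.
rewrite (partition_big (fun E : {set T} => inord #|E| : 'I_#|D|.+1) predT) //=.
apply: eq_bigr => p _; rewrite -cards_draws -sum_nat_const.
have Ep (E : {set T}) : E \subset D ->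
    (inord #|E| == p :> 'I_#|D|.+1) = (#|E| == p).
  by move=> ED; rewrite -val_eqE /= inordK // ltnS subset_leq_card.
apply: eq_big => [E|E /andP[ED]]; last by rewrite Ep // => /eqP->.
by rewrite !inE; case ED : (E \subset D); rewrite //= Ep.
Qed.

Section ParkingCount.

Variables (T : finType) (M : nat).
Implicit Types (D E : {set T}) (f : {ffun T -> 'I_M.+1}).

(* Functions on D, extended to T by the constant M. *)
Definition parking_on D r : {set {ffun T -> 'I_M.+1}} :=
  [set f : {ffun T -> 'I_M.+1} |
           [forall t, if t \in D then f t < r else f t == ord_max] &&
           [forall i : 'I_M.+1, (i < r) ==> (i < #|[set t in D | f t <= i]|)]].

Lemma parking_onP D r f : r <= M.+1 ->
  reflect [/\ forall t, t \in D -> f t < r,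
              forall t, t \notin D -> f t = ord_max &
              forall i, i < r -> i < #|[set t in D | f t <= i]|]
          (f \in parking_on D r).
Proof.
move=> rM; rewrite inE; apply: (iffP andP).
  move=> [/forallP fD /forallP cnt]; split=> [t tD|t tD|i ir].
  - by have := fD t; rewrite tD.
  - by have := fD t; rewrite (negPf tD) => /eqP.
  by have /implyP/(_ ir) := cnt (Ordinal (leq_trans ir rM)).
move=> [fD fC cnt]; split; apply/forallP => t.
  by case: ifPn => [/fD|/fC->].
by apply/implyP; apply: cnt.
Qed.

Lemma parking_on_small D r : #|D| <= r -> r <= M -> parking_on D r.+1 = set0.
Proof.
move=> Dr rM; apply/setP => f; rewrite in_set0; apply/negP.
case/parking_onP => // _ _ /(_ r (leqnn _)); rewrite ltnNge => /negP; apply.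
by apply: leq_trans Dr; apply: subset_leq_card; apply/subsetP => t; rewrite inE => /andP[].
Qed.

(** A member of the fibre is constantly [r] on [D :\: E], so [fill] inverts restriction to [E]. The
    count conditions below [r] only see [E], and the one at [r] is [r < #|D|]. *)
Lemma card_parking_on_fiber D E r : r <= M -> r < #|D| -> E \subset D ->
  #|[set f in parking_on D r.+1 | [set t in D | f t < r] == E]| = #|parking_on E r|.
Proof.
move=> rM rD ED.
pose fill f : {ffun T -> 'I_M.+1} := [ffun t => if t \in D :\: E then inord r else f t].
have fillE f t : t \in E -> fill f t = f t by move=> tE; rewrite ffunE inE tE.
rewrite -(@card_in_imset _ _ fill (mem (parking_on E r))); last first.
  move=> f g /(parking_onP _ _ (leqW rM))[_ fC _] /(parking_onP _ _ (leqW rM))[_ gC _].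
  move=> /ffunP fg; apply/ffunP => t; case: (boolP (t \in E)) => tE.
    by have := fg t; rewrite !fillE.
  by rewrite fC ?gC.
apply: eq_card => f; rewrite inE; apply/andP/imsetP.
  move=> [/parking_onP[] // fD fC cnt /eqP fE].
  have inE' t : (t \in E) = (t \in D) && (f t < r) by rewrite -fE inE.
  exists [ffun t => if t \in E then f t else ord_max].
    apply/parking_onP; first exact: leqW.
    split=> [t tE|t tE|i ir]; rewrite ?ffunE ?tE ?(negPf tE) //.
      by move: tE; rewrite inE' => /andP[].
    apply: leq_trans (cnt i (leqW ir)) _; apply: subset_leq_card.
    apply/subsetP => t; rewrite !inE => /andP[tD le].
    have tE : t \in E by rewrite inE' tD (leq_ltn_trans le).
    by rewrite ffunE tE.
  apply/ffunP => t; rewrite !ffunE inE; case: (boolP (t \in E)) => //= tE.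
  case: ifP => [tD|/negbT /fC //]; apply/val_inj; rewrite /= inordK ?ltnS //.
  apply/eqP; rewrite eqn_leq -ltnS fD //= leqNgt.
  by apply: contra tE => lt; rewrite inE' tD.
move=> [g /(parking_onP _ _ (leqW rM))[gE gC cnt] ->{f}].
have fill_lt t : (t \in D) && (fill g t < r) = (t \in E).
  case: (boolP (t \in E)) => tE; first by rewrite fillE // gE // (subsetP ED).
  by rewrite ffunE inE tE /=; case: (boolP (t \in D)) => //= tD; rewrite inordK // ltnn.
split; last by apply/eqP/setP => t; rewrite inE fill_lt.
apply/parking_onP => //; split=> [t tD|t tD|i].
- by rewrite ffunE inE tD andbT; case: (boolP (t \in E)) => [/gE/leqW|_] //=; rewrite inordK.
- by rewrite ffunE inE (negPf tD) andbF gC //; apply: contra tD => /(subsetP ED).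
rewrite ltnS leq_eqVlt => /predU1P[->|ir].
  apply: leq_trans rD _; apply: subset_leq_card; apply/subsetP => t tD.
  rewrite inE tD ffunE inE tD andbT; case: (boolP (t \in E)) => [/gE/ltnW|_] //=.
  by rewrite inordK.
apply: leq_trans (cnt i ir) _; apply: subset_leq_card.
apply/subsetP => t; rewrite !inE => /andP[tE le].
by rewrite (subsetP ED) // fillE.
Qed.

Lemma card_parking_on D r : r <= M.+1 -> #|parking_on D r| = parking_count r #|D|.
Proof.
elim: r D => [|r IHr] D rM /=.
  have [D0|D0] := eqVneq #|D| 0.
    apply: etrans (cards1 ([ffun=> ord_max] : {ffun T -> 'I_M.+1})).
    apply: eq_card => f; rewrite in_set1; apply/(parking_onP _ _ (leq0n _))/eqP.
      by move=> [_ fC _]; apply/ffunP => t; rewrite ffunE fC // (cards0_eq D0) inE.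
    by move=> ->; split=> // t; rewrite ?ffunE // (cards0_eq D0) inE.
  apply/eqP; rewrite cards_eq0; apply/eqP/setP => f; rewrite in_set0; apply/negP.
  have /card_gt0P[t tD] : 0 < #|D| by rewrite lt0n.
  by case/parking_onP => // /(_ t tD).
case: ifPn => [rD|]; last first.
  by rewrite -leqNgt => Dr; rewrite parking_on_small // cards0.
rewrite -(sum_subsets D (parking_count r)) -sum1_card.
rewrite (partition_big (fun f => [set t in D | f t < r]) (fun E => E \subset D)) /=.
  apply: eq_bigr => E ED; rewrite -IHr ?(ltnW rM) //.
  by rewrite -(card_parking_on_fiber rM rD ED) -sum1_card; apply: eq_bigl => f; rewrite inE.
by move=> f _; apply/subsetP => t; rewrite inE => /andP[].
Qed.

End ParkingCount.

(** * Closed forms for the recursion *)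

Lemma parking_count_small r n : n < r -> parking_count r n = 0.
Proof. by case: r => //= r; rewrite ltnS leqNgt => /negPf->. Qed.

Lemma sum_bin_expn n q x :
  \sum_(p < n.+1) 'C(n, p) * ('C(p, q) * x ^ (p - q)) = 'C(n, q) * x.+1 ^ (n - q).
Proof.
have [nq|qn] := ltnP n q.
  rewrite (bin_small nq) big1 // => p _.
  by rewrite (bin_small (leq_ltn_trans _ nq)) ?muln0 // -ltnS.
rewrite -[x.+1]add1n expnDn big_distrr /=.
rewrite -(big_mkord xpredT (fun p => 'C(n, p) * ('C(p, q) * x ^ (p - q)))).
rewrite (@big_cat_nat _ _ _ q) //=; last exact: leqW.
rewrite big_nat_cond big1 => [|p]; last first.
  by rewrite andbT => /andP[_ pq]; rewrite (bin_small pq) muln0.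
rewrite add0n -{1}[q]add0n big_addn big_mkord subSn //; apply: eq_bigr => i _.
rewrite addnK mulnA mul_bin_sub ?addnK; last by have := ltn_ord i; lia.
by rewrite exp1n mul1n mulnA.
Qed.

(** Classifies all maps to [r] values by the first [p] where the count condition fails: then exactly
    [p] cars lie below [p], forming a parking function, none equals [p], and the rest take the
    [r - p.+1] larger values. The proof is an induction on [r]. *)
Lemma expn_parking_count r n :
  r ^ n = parking_count r n +
    \sum_(p < r) 'C(n, p) * parking_count p p * (r - p.+1) ^ (n - p).
Proof.
elim: r n => [|r IHr] n; first by rewrite big_ord0 addn0; case: n => [|n] //=; rewrite exp0n.
(* The extra term can be nonzero only for [n = r], where [0 ^ 0 = 1]; this restores what the guard
   of [parking_count] discards. *)
have sumF : \sum_(p < n.+1) 'C(n, p) * parking_count r p =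
    parking_count r.+1 n + 'C(n, r) * parking_count r r * (r.+1 - r.+1) ^ (n - r).
  rewrite /= subnn; case: ltnP => [rn|nr]; first by rewrite exp0n ?subn_gt0 // muln0 addn0.
  rewrite big_ord_recr /= big1 => [|p _].
    rewrite binn mul1n !add0n; move: nr; rewrite leq_eqVlt => /predU1P[->|nr].
      by rewrite binn subnn mul1n muln1.
    by rewrite (bin_small nr) parking_count_small.
  by rewrite parking_count_small ?muln0 // (leq_trans (ltn_ord p)).
rewrite -[in LHS](add1n r) expnDn [X in _ = _ + X]big_ord_recr /=.
rewrite [X in _ = _ + X]addnC addnA -/(parking_count r.+1 n) -sumF.
under eq_bigr => p _ do rewrite exp1n mul1n IHr mulnDr.
rewrite big_split /=; congr (_ + _).
under eq_bigr => p _ do rewrite big_distrr.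
rewrite exchange_big; apply: eq_bigr => q _ /=.
rewrite (_ : r.+1 - q.+1 = (r - q.+1).+1); last by have := ltn_ord q; lia.
rewrite -mulnA mulnCA -sum_bin_expn big_distrr; apply: eq_bigr => p _ /=.
by ring.
Qed.

Section ClosedForms.
Local Open Scope ring_scope.

(** Abel's identity at [n - 1] and [expn_parking_count] both expand [n ^ n]; by induction the terms
    with [p < n] agree, hence so do the remaining ones. *)
Lemma parking_count_diag n : parking_count n n = (n.+1 ^ n.-1)%N.
Proof.
elim/ltn_ind: n => n IHn; apply/eqP; rewrite -(eqr_nat int) natrX; apply/eqP.
have := abel_sum n (n%:R - 1 : int); rewrite subrK -[n%:R ^+ n]natrX (expn_parking_count n n).
rewrite natrD natr_sum big_ord_recr /= subnn expr0 binn mul1r mulr1 addrC.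
set A := \sum_(i < n) _; set B := \sum_(i < n) _.
suff -> : A = B by move/addIr.
apply: eq_bigr => p _; rewrite (IHn p) // !natrM !natrX natrB ?ltn_ord //.
by congr (_ * _ ^+ _); rewrite -natr1; ring.
Qed.

(** Abel's identity at [f] expands [f.+1 ^ n]; its terms up to [f] are those of
    [expn_parking_count], so the tail is the wanted count. It is then reversed by [j = n - k]. *)
Lemma parking_count_sum f n : (f < n)%N ->
  (parking_count f.+1 n)%:Z =
  \sum_(0 <= j < (n - f - 1).+1)
     (-1) ^+ j * 'C(n, j)%:Z * (n%:Z - f%:Z - j%:Z) ^+ j *
     (n%:Z - j%:Z + 1) ^+ (n - j - 1).
Proof.
move=> fn; have := abel_sum n (f%:R : int).
rewrite natr1 -[f.+1%:R ^+ n]natrX (expn_parking_count f.+1 n) natrD natr_sum.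
rewrite -(big_mkord xpredT (fun k => 'C(n, k)%:R * k.+1%:R ^+ k.-1 * (f%:R - k%:R) ^+ (n - k))).
rewrite (@big_cat_nat _ _ _ f.+1) //; last exact: ltnW.
rewrite big_mkord addrC.
set A := \sum_(i < f.+1) _; set B := \sum_(i < f.+1) _.
have -> : A = B.
  apply: eq_bigr => p _; rewrite parking_count_diag !natrM !natrX.
  by rewrite subSS natrB // -ltnS.
move=> /addrI E; rewrite -[LHS]natz -E big_nat_rev /= -{1}[f.+1]add0n big_addn.
rewrite (_ : (n.+1 - f.+1)%N = (n - f - 1).+1); last by lia.
apply: eq_big_nat => j /andP[_ jn].
have -> : (f.+1 + n.+1 - (j + f.+1).+1)%N = (n - j)%N by lia.
have jn' : (j <= n)%N by lia.
rewrite bin_sub // subKn //.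
have -> : ((n - j).-1 = n - j - 1)%N by rewrite subn1.
have -> : (n - j).+1%:R = n%:Z - j%:Z + 1 :> int by rewrite -natr1 natrB // !natz.
have -> : f%:R - (n - j)%:R = - 1 * (n%:Z - f%:Z - j%:Z) :> int.
  by rewrite natrB // !natz; ring.
by rewrite exprMn natz; ring.
Qed.

End ClosedForms.

(** * Nondecreasing parking functions and ballot numbers *)

Lemma sorted_rcons_leq s x :
  sorted leq (rcons s x) = all (leq^~ x) s && sorted leq s.
Proof. by rewrite !(sorted_pairwise leq_trans) pairwise_rcons. Qed.

(** The last entry [j] is below [r] and at most its index; the earlier entries may equal [j], hence
    the new bound [j.+1]. *)
Fixpoint ballot_seqs (r n : nat) : seq (seq nat) :=
  if n is n'.+1 then
    [seq rcons s j | j <- iota 0 (minn r n), s <- ballot_seqs j.+1 n']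
  else [:: [::]].

Lemma mem_ballot_seqs r n s :
  (s \in ballot_seqs r n) =
  [&& size s == n, sorted leq s, all (ltn^~ r) s & all (fun i => nth 0 s i <= i) (iota 0 n)].
Proof.
elim: n r s => [|n IHn] r s; first by case: s.
apply/allpairsPdep/and4P.
  move=> [j [t [+ + ->]]]; rewrite mem_iota add0n leq_min IHn => /and3P[_ jr jn].
  move=> /and4P[/eqP tn srt /allP tj /allP pos]; split.
  - by rewrite size_rcons tn.
  - by rewrite sorted_rcons_leq srt andbT; exact/allP.
  - rewrite all_rcons /= jr; apply/allP => x /tj /= xj; apply: leq_trans xj jr.
  apply/allP => i; rewrite mem_iota /= add0n ltnS => il; rewrite nth_rcons tn.
  by case: ltngtP il => // [il _|-> _]; [apply: pos; rewrite mem_iota|].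
move=> [/eqP]; case/lastP: s => // t j; rewrite size_rcons => -[tn].
rewrite all_rcons => srt /andP[jr tr] /allP pos; exists j, t; split=> //.
  rewrite mem_iota add0n leq_min [j < r]jr /=; have := pos n; rewrite mem_iota leqnn.
  by rewrite nth_rcons tn ltnn eqxx ltnS => ->.
move: srt; rewrite sorted_rcons_leq => /andP[tj srt_t].
rewrite IHn tn eqxx srt_t /=; apply/andP; split=> //.
apply/allP => i; rewrite mem_iota /= => il.
have := pos i; rewrite mem_iota /= nth_rcons tn il; apply.
exact: ltnW.
Qed.

Lemma ballot_seqs_uniq r n : uniq (ballot_seqs r n).
Proof.
elim: n r => [|n IHn] r //=; apply: allpairs_uniq_dep.
- exact: iota_uniq.
- by move=> j _; apply: IHn.
by move=> [j s] [l t] _ _ /= /rcons_inj[<- <-].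
Qed.

(** Partial sums of a row of ballot numbers, [(n.+1 - j) / n.+1] times ['C(n + j, j)], give the next
    row; denominators are cleared. *)
Lemma sum_ballot n f : f <= n.+1 ->
  n.+2 * \sum_(j < f.+1) (n.+1 - j) * 'C(n + j, j) =
  n.+1 * ((n.+2 - f) * 'C(n.+1 + f, f)).
Proof.
elim: f => [|f IHf] fn.
  by rewrite big_ord_recl big_ord0 /= !subn0 !addn0 !bin0 !muln1 mulnC.
rewrite big_ord_recr mulnDr IHf /=; last exact: ltnW.
(* This removes the truncated subtractions, so that [ring] can conclude. *)
have [d nE] : exists d, n = f + d by exists (n - f); lia.
have := mul_bin_left (n.+1 + f) f.
rewrite addnK [n.+1 + f.+1]addnS binS -[n + f.+1]addSnnS.
move: ('C(_, f)) ('C(_, f.+1)) => A B; rewrite {}nE => AB.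
rewrite (_ : (f + d).+2 - f = d.+2); last lia.
rewrite (_ : (f + d).+1 - f.+1 = d); last lia.
rewrite (_ : (f + d).+2 - f.+1 = d.+1); last lia.
by apply: (@addIn (f.+1 * B)); rewrite [in RHS]AB; ring.
Qed.

Lemma size_ballot_seqs n f : f <= n ->
  n.+1 * size (ballot_seqs f.+1 n) = (n.+1 - f) * 'C(n + f, f).
Proof.
elim: n f => [|n IHn] f; first by rewrite leqn0 => /eqP->.
move=> fn; apply/eqP; rewrite -(eqn_pmul2l (ltn0Sn n)); apply/eqP.
rewrite -sum_ballot // mulnCA; congr (_ * _).
rewrite size_allpairs_dep sumnE big_map.
rewrite -[X in iota 0 X]subn0 big_mkord big_distrr /=.
have termE (j : 'I_(minn f.+1 n.+1)) :
    n.+1 * size (ballot_seqs j.+1 n) = (n.+1 - j) * 'C(n + j, j).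
  by apply: IHn; have := ltn_ord j; lia.
under eq_bigr => j _ do rewrite termE.
have [le|lt] := leqP f n.
  by rewrite (_ : minn f.+1 n.+1 = f.+1) //; lia.
(* The list of last entries stops at [n], but the additional summand has the factor
   [n.+1 - n.+1]. *)
have -> : f = n.+1 by lia.
rewrite (_ : minn n.+2 n.+1 = n.+1); last by lia.
by rewrite [RHS]big_ord_recr /= subnn mul0n addn0.
Qed.

(** * Transfer of the counts to invariant parking assortments *)

Section Cardinals.

Variables (k a b : nat) (ha : 0 < a) (hb : 0 < b).
Local Notation n := k.+1.
Local Notation y := (lengths_ba n a b).
Local Notation r := (max_step n a b).

Lemma max_step_le : r <= n.
Proof. by rewrite /max_step; case: ifP => // _; apply: geq_minl. Qed.

Lemma prefs_steps s : size s = n -> (forall j, j \in s -> j < n) ->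
  exists x : n.-tuple 'I_(street_length y), prefs x = [seq 1 + j * a | j <- s].
Proof.
move=> sz_s lt_s.
have lt j : j \in s -> j * a < street_length y.
  move=> /lt_s jk; rewrite street_length_ba // subn1 /= -[_ * a]add0n.
  by rewrite -addSn leq_add // leq_mul2r -ltnS jk orbT.
have street0 : 0 < street_length y by rewrite street_length_ba // addn_gt0 hb.
have sz : size [seq insubd (Ordinal street0) (j * a) | j <- s] == n.
  by rewrite size_map sz_s.
exists (Tuple sz); rewrite /prefs /= -map_comp; apply/eq_in_map => j js /=.
by rewrite insubdK // unfold_in lt.
Qed.

Lemma prefs_inj : injective (@prefs n y).
Proof. by move=> x z /inj_map E; apply/val_inj/E => p q [/val_inj]. Qed.

(** An ordinal is already its spot minus 1, so it is divided by [a] directly. *)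
Let steps (x : n.-tuple 'I_(street_length y)) := [seq val p %/ a | p <- x].

Lemma stepsE x s : prefs x = [seq 1 + j * a | j <- s] -> steps x = s.
Proof.
move=> xE; have -> : steps x = [seq v.-1 %/ a | v <- prefs x] by rewrite -map_comp.
by rewrite xE -map_comp map_id_in // => j _ /=; rewrite add0n mulnK.
Qed.

Lemma card_PAinv_nondecr : #|PAinv_nondecr y| = size (ballot_seqs r n).
Proof.
have inE' x : x \in PAinv_nondecr y -> exists2 ks, prefs x = [seq 1 + j * a | j <- ks] &
    restricted_parking r ks.
  by rewrite inE => /andP[/(mem_PAinv _ ha hb)].
rewrite cardE -(size_map steps); apply/perm_size/uniq_perm.
- rewrite map_inj_in_uniq ?enum_uniq // => x z.
  rewrite !mem_enum => /inE'[s xE _] /inE'[t zE _].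
  by rewrite (stepsE xE) (stepsE zE) => st; apply: prefs_inj; rewrite xE zE st.
- exact: ballot_seqs_uniq.
have sorted_steps s : sorted leq [seq 1 + j * a | j <- s] = sorted leq s.
  by rewrite sorted_map; apply: eq_sorted => i j /=; rewrite leq_add2l leq_pmul2r.
have restrictedE s : sorted leq s -> size s = n ->
    restricted_parking r s = all (ltn^~ r) s && all (fun i => nth 0 s i <= i) (iota 0 n).
  move=> srt sz; rewrite /restricted_parking sz; congr andb.
  by apply: eq_in_all => i; rewrite mem_iota => /= ilt; rewrite nth_sorted_le ?sz.
move=> s; rewrite mem_ballot_seqs; apply/mapP/and4P.
  move=> [x]; rewrite mem_enum => xP ->; have [ks xE rks] := inE' x xP.
  rewrite (stepsE xE); move: xP; rewrite inE xE sorted_steps => /andP[_ srt].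
  have sz : size ks = n.
    by have := size_map (fun j => 1 + j * a) ks; rewrite -xE size_map size_tuple.
  by move: rks; rewrite restrictedE // sz eqxx srt => /andP[].
move=> [/eqP sz srt lt pos].
have [|x xE] := prefs_steps sz.
  by move=> j /(allP lt) /= jr; apply: leq_trans max_step_le.
exists x; last by rewrite (stepsE xE).
rewrite mem_enum inE xE sorted_steps srt andbT; apply/(mem_PAinv _ ha hb).
by exists s => //; rewrite restrictedE // lt.
Qed.

(** One side imposes the count condition for [i < n], the other for [i < r]; from [r] on every entry
    is counted. *)
Lemma restricted_parking_on (f : {ffun 'I_n -> 'I_n}) :
  restricted_parking r [seq val (f t) | t <- enum 'I_n] = (f \in parking_on k setT r).
Proof.
have cntE i : count (leq^~ i) [seq val (f t) | t <- enum 'I_n] = #|[set t in setT | f t <= i]|.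
  rewrite count_map -size_filter cardE /enum_mem -enumT; congr size.
  by rewrite -filter_predI; apply: eq_filter => t; rewrite /= !inE andbC.
apply/restricted_parkingP/(parking_onP _ _ max_step_le).
  rewrite size_map size_enum_ord => -[lt cnt]; split=> [t _|t|i ir].
  - by apply: lt; apply: map_f; rewrite mem_enum.
  - by rewrite inE.
  by rewrite -cntE cnt // (leq_trans ir) // max_step_le.
rewrite size_map size_enum_ord => -[lt _ cnt].
have lt' j : j \in [seq val (f t) | t <- enum 'I_n] -> j < r by move=> /mapP[t _ ->]; apply: lt.
have sz : size [seq val (f t) | t <- enum 'I_n] = n by rewrite size_map size_enum_ord.
split=> // i ik; have [ir|ri] := ltnP i r; first by rewrite cntE cnt.
rewrite (@eq_in_count _ _ predT) ?count_predT ?sz // => j /lt' jr /=.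
by rewrite (leq_trans (ltnW jr)).
Qed.

Lemma card_PAinv : #|PAinv y| = parking_count r n.
Proof.
transitivity #|parking_on k [set: 'I_n] r|; last first.
  by rewrite card_parking_on ?max_step_le // cardsT card_ord.
(* On invariant assortments the steps are below [n], so [inord] leaves them unchanged. *)
pose step_fun (x : n.-tuple 'I_(street_length y)) :=
  [ffun t : 'I_n => inord (nth 0 (steps x) t) : 'I_n].
have step_funE x s : prefs x = [seq 1 + j * a | j <- s] -> restricted_parking r s ->
    [seq val (step_fun x t) | t <- enum 'I_n] = s.
  move=> xE /restricted_parkingP[lt_s _].
  have sz : size s = n by have := size_map (fun j => 1 + j * a) s; rewrite -xE size_map size_tuple.
  have -> : [seq val (step_fun x t) | t <- enum 'I_n] = [seq nth 0 s i | i <- iota 0 n].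
    rewrite -val_enum_ord -map_comp; apply: eq_map => t /=.
    rewrite ffunE (stepsE xE) inordK //; apply: leq_trans max_step_le.
    by apply: lt_s; rewrite mem_nth ?sz.
  by rewrite -sz; apply: mkseq_nth.
rewrite -(@card_in_imset _ _ step_fun (mem (PAinv y))); last first.
  move=> x z /(mem_PAinv _ ha hb)[s xE rs] /(mem_PAinv _ ha hb)[t zE rt] E.
  by apply: prefs_inj; rewrite xE zE -(step_funE _ _ xE rs) -(step_funE _ _ zE rt) E.
apply: eq_card => f; rewrite -restricted_parking_on; apply/imsetP/idP.
  by move=> [x /(mem_PAinv _ ha hb)[s xE rs] ->]; rewrite (step_funE _ _ xE rs).
move=> rf; have sz : size [seq val (f t) | t <- enum 'I_n] = n.
  by rewrite size_map size_enum_ord.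
have [|x xE] := prefs_steps sz; first by move=> _ /mapP[t _ ->]; apply: ltn_ord.
exists x; first by apply/(mem_PAinv _ ha hb); exists [seq val (f t) | t <- enum 'I_n].
apply/ffunP => t; apply/val_inj; have := step_funE _ _ xE rf.
by move/eq_in_map => /(_ t); rewrite mem_enum => /(_ isT).
Qed.

End Cardinals.

(** * The two cases of the theorem *)

Lemma PAinv_order_stat k a b (x : k.+1.-tuple 'I_(street_length (lengths_ba k.+1 a b))) :
  0 < a -> 0 < b ->
  x \in PAinv (lengths_ba k.+1 a b) <->
  (forall i, 1 <= i <= k.+1 -> order_stat x i \in
     [seq 1 + (j - 1) * a | j <- iota 1 (minn i (max_step k.+1 a b))]).
Proof.
move=> ha hb; apply: iff_trans (mem_PAinv x ha hb) _.
apply: iff_trans (restricted_parking_sort _ _ ha) _.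
by rewrite size_map size_tuple.
Qed.

Lemma card_PAinv_nondecr_frac k a b f : 0 < a -> 0 < b ->
  max_step k.+1 a b = f.+1 ->
  (#|PAinv_nondecr (lengths_ba k.+1 a b)|%:R =
     (k.+1 - f + 1)%:R / (k.+1 + 1)%:R * 'C(k.+1 + f, f)%:R :> rat)%R.
Proof.
move=> ha hb fE; rewrite card_PAinv_nondecr // fE.
have fk : f <= k by have := max_step_le k a b; rewrite fE.
apply: (mulfI (x := (k.+1 + 1)%:R%R)); first by rewrite pnatr_eq0 addn1.
rewrite mulrA mulrCA mulfV ?mulr1 -?natrM ?pnatr_eq0 ?addn1 //.
by rewrite size_ballot_seqs ?(leqW fk) // subSn // ltnW.
Qed.

Theorem theorem3 (n a b : nat) (hn : 2 <= n) (ha : 0 < a) (hb : 0 < b) :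
  let y := lengths_ba n a b in
  let f := b %/ a in
  ((a %| b) || ((n - 1) * a < b) ->
     (forall x : n.-tuple 'I_(street_length y),
        x \in PAinv y <->
        (forall i : nat, 1 <= i <= n ->
           order_stat x i \in [seq 1 + (k - 1) * a | k <- iota 1 i])) /\
     #|PAinv y| = (n + 1) ^ (n - 1) /\
     (#|PAinv_nondecr y|%:R = (n + 1)%:R^-1 * 'C(2 * n, n)%:R :> rat)%R) /\
  (~~ (a %| b) -> b < (n - 1) * a ->
     (forall x : n.-tuple 'I_(street_length y),
        x \in PAinv y <->
        (forall i : nat, 1 <= i <= f + 1 ->
           order_stat x i \in [seq 1 + (k - 1) * a | k <- iota 1 i]) /\
        (forall i : nat, f + 1 < i <= n ->
           order_stat x i \in [seq 1 + (k - 1) * a | k <- iota 1 (f + 1)])) /\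
     (#|PAinv y|%:Z =
        \sum_(0 <= j < (n - f - 1).+1)
          (-1) ^+ j * 'C(n, j)%:Z * (n%:Z - f%:Z - j%:Z) ^+ j *
          (n%:Z - j%:Z + 1) ^+ (n - j - 1) :> int)%R /\
     (#|PAinv_nondecr y|%:R =
        (n - f + 1)%:R / (n + 1)%:R * 'C(n + f, f)%:R :> rat)%R).
Proof.
case: n hn => // k hk y f; have kE : k.+1 - 1 = k by rewrite subn1.
split=> [hab|hab hlt].
  have stepE : max_step k.+1 a b = k.+1.
    rewrite /max_step; case: ifP hab => //= _; rewrite kE => lt.
    by apply/minn_idPl; rewrite ltnS leq_divRL // ltnW.
  split; first move=> x; last split.
  - apply: iff_trans (PAinv_order_stat x ha hb) _; rewrite stepE.
    by split=> stat i ik; have := stat i ik; have /andP[_ /minn_idPl ->] := ik.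
  - by rewrite card_PAinv // stepE parking_count_diag addn1 subn1.
  (* At [f = k] the ballot formula has the factor 2, absorbed by Pascal's rule and symmetry into the
     central binomial coefficient. *)
  rewrite (card_PAinv_nondecr_frac ha hb stepE) (_ : k.+1 - k + 1 = 2); last by lia.
  rewrite mulrAC [RHS]mulrC -natrM; congr (_%:R / _)%R.
  rewrite (_ : 2 * k.+1 = (k.+1 + k).+1); last by lia.
  rewrite binS -[X in _ = X + _]bin_sub; last by lia.
  by rewrite (_ : k.+1 + k - k.+1 = k) ?mul2n ?addnn //; lia.
have fk : f < k by rewrite ltn_divLR // -kE.
have stepE : max_step k.+1 a b = f.+1.
  by rewrite /max_step (negPf hab); apply/minn_idPr; rewrite ltnS ltnW // ltnW.
split; first move=> x; last split.
- apply: iff_trans (PAinv_order_stat x ha hb) _; rewrite stepE addn1.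
  split=> [stat|[stat1 stat2] i /andP[i0 ik]].
    split=> i /andP[i0 ik].
      by have := stat i; rewrite (minn_idPl ik) i0 (leq_trans ik) //; [apply|lia].
    by have := stat i; rewrite (minn_idPr (ltnW i0)) ik (leq_trans _ i0) //; apply.
  case: (leqP i f.+1) => ilt; first by rewrite stat1 ?i0.
  by rewrite stat2 ?ilt.
- by rewrite card_PAinv // stepE parking_count_sum // ltnW // ltnW.
exact: card_PAinv_nondecr_frac.
Qed.
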